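(* Let $\Omega\subset\mathbb{R}^d$ be compact, let $p\in(1,\infty)$, and let $V=\{V_j(\Omega)\}_{j\in\mathbb{N}}$ be a multiresolution analysis with properties MRA1), MRA2), MRA3) listed in the context, with projectors $P_j$ given by biorthogonal dual bases as in the context. For every $j\in\mathbb{N}$ there exists $\Delta_j>0$ (large enough) such that for every $\Delta_j$-dense sampling set $X_j=\{x_{j,\ell}\}_{\ell=0}^{M_j}\subset\Omega$ and every partition $\Psi_j$ associated to $X_j$, the procedure $\mathbf{INTEGRATE}$ (defined in the context from $P_j$, $X_j$, $\Psi_j$) has the following properties: (i) it is linear, i.e. $$\mathbf{INTEGRATE}[n,\lambda\mathbf{f}^s+\mu\mathbf{g}^s]=\lambda\cdot\mathbf{INTEGRATE}[n,\mathbf{f}^s]+\mu\cdot\mathbf{INTEGRATE}[n,\mathbf{g}^s]$$ for all $n\in\mathbb{N}$, all sample vectors $\mathbf{f}^s,\mathbf{g}^s\in\mathbb{C}^{M_j+1}$ and all $\lambda,\mu\in\mathbb{C}$; (ii) for all $f_j\in V_j(\Omega)$, with $\mathbf{f}_j^s=[f_j(x_{j,0}),\dots,f_j(x_{j,M_j})]^T$, $$\int_\Omega f_j(x)\,dx=\mathbf{INTEGRATE}[\infty,\mathbf{f}_j^s]:=\lim_{n\to\infty}\mathbf{INTEGRATE}[n,\mathbf{f}_j^s].$$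
   Context: Setting. $\Omega\subset\mathbb{R}^d$ is compact, $\chi_\Omega$ is the constant function $1$ on $\Omega$, $B_\delta(x)$ is the ball of center $x$ and radius $\delta$, and $\langle f,g\rangle=\int_\Omega f\overline{g}\,dx$. $C^1(\Omega,\mathbb{R}_+)$ denotes the nonnegative continuously differentiable functions on $\Omega$ (restrictions to $\Omega$ of functions that are $C^1$ in a neighbourhood of $\Omega$). MRA1) $V=\{V_j(\Omega)\}_{j\in\mathbb{N}}$ are finite dimensional spaces such that for all $q\in(1,\infty)$: $\chi_\Omega\in V_0(\Omega)\subset V_1(\Omega)\subset\dots\subset V_j(\Omega)\subset\dots\subset L^q(\Omega)$ and $\bigcup_jV_j(\Omega)$ is dense in $L^q(\Omega)$. MRA2) Each $V_j(\Omega)$ has a basis $\Phi_j=\{\phi_{j,0},\dots,\phi_{j,N_j}\}\subset C^1(\Omega,\mathbb{R}_+)$ such that $\Phi_{j-1}=A_j\Phi_j$ for a suitable (stochastic) real scaling matrix $A_j$ of size $(N_{j-1}+1)\times(N_j+1)$, and $2^{-dj/2}\sum_{k=0}^{N_j}\phi_{j,k}\equiv1$ for all $j$. Moreover there are $C>0$ and $m\in\mathbb{N}$, independent of $j$ and $k$, such that $\operatorname{diam}(\operatorname{supp}\phi_{j,k})\le C2^{-j}$, $\#\{k:\operatorname{supp}(\phi_{j,k})\cap\operatorname{supp}(\phi_{j,k'})\ne\emptyset\}\le m$ for all $k'$, and $\|\nabla\phi_{j,k}\|_\infty\le C2^{j(d/2+1)}$. MRA3) For each $j$, $P_j:L^p(\Omega)\to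 V_j(\Omega)$ is a linear projector ($P_jf=f$ for all $f\in V_j(\Omega)$) which is bounded with respect to the sup-norm on bounded functions (in particular from $C(\Omega)$ to $V_j(\Omega)$, both with the sup-norm), and $f=\lim_{j\to\infty}P_jf$ in $L^p(\Omega)$ for all $f\in L^p(\Omega)$. Form of the projectors: $P_jf=\sum_{k=0}^{N_j}\langle f,\tilde\phi_{j,k}\rangle\phi_{j,k}$ for $f\in L^2(\Omega)\cap L^p(\Omega)$, where $\{\tilde\phi_{j,k}\}_{k=0}^{N_j}\subset L^2(\Omega)$ is a biorthogonal dual basis to $\Phi_j$, i.e. $\langle\phi_{j,h},\tilde\phi_{j,k}\rangle=\delta_{h,k}$. Sampling sets. A finite set $X=\{x_\ell\}_{\ell=0}^M\subset\Omega$ is called $\Delta$-dense ($\Delta>0$) if, with $\delta=\Delta^{-1}$, $\Omega=\big(\bigcup_{\ell=0}^MB_\delta(x_\ell)\big)\cap\Omega$. A partition associated to a $\Delta$-dense set $X$ is a set $\Psi=\{\psi_\ell\}_{\ell=0}^M\subset L^\infty(\Omega)$ with $0\le\psi_\ell\le1$, $\operatorname{supp}(\psi_\ell)\subset B_\delta(x_\ell)$ and $\sum_{\ell=0}^M\psi_\ell\equiv1$ on $\Omega$. Procedure $\mathbf{INTEGRATE}$. Given $j$, $X_j=\{x_{j,\ell}\}_{\ell=0}^{M_j}$ and $\Psi_j=\{\psi_{j,\ell}\}_{\ell=0}^{M_j}$, put $\mathbf{M}=(\langle\psi_{j,\ell},\tilde\phi_{j,k}\rangle)_{k=0,\dots,N_j;\,\ell=0,\dots,M_j}$,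 $\mathbf{\Phi}^s=(\phi_{j,k}(x_{j,\ell}))_{\ell=0,\dots,M_j;\,k=0,\dots,N_j}$, $\mathbf{PQ}_s=\mathbf{\Phi}^s\mathbf{M}$ and $\omega_j=[\int_\Omega\phi_{j,0}\,dx,\dots,\int_\Omega\phi_{j,N_j}\,dx]^T$. For an input vector $\mathbf{v}\in\mathbb{C}^{M_j+1}$ define $$I^{(0)}=\omega_j^T\mathbf{M}\mathbf{v},\quad \mathbf{u}^{(0)}=\mathbf{PQ}_s\mathbf{v},\qquad I^{(i+1)}=I^{(i)}+\omega_j^T\mathbf{M}(\mathbf{v}-\mathbf{u}^{(i)}),\quad \mathbf{u}^{(i+1)}=\mathbf{u}^{(i)}+\mathbf{PQ}_s(\mathbf{v}-\mathbf{u}^{(i)})\quad(i\ge0).$$ The output is $\mathbf{INTEGRATE}[n,\mathbf{v}]=I^{(n+1)}$ (the update loop is executed while the counter $i$, starting from $0$ and increased by one at each pass, satisfies $i\le n$). *)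

(* Defs.v *)
From HB Require Import structures.
From mathcomp Require Import all_boot all_order all_algebra.
From mathcomp Require Import complex.
From mathcomp Require Import all_classical all_reals all_analysis.

Set Implicit Arguments.
Unset Strict Implicit.
Unset Printing Implicit Defensive.

Import Order.TTheory GRing.Theory Num.Theory.
Import numFieldNormedType.Exports.

Local Open Scope classical_set_scope.
Local Open Scope ring_scope.

(* R^d is 'rV[R]_d, with the product sigma-algebra (the one generated by the
   coordinates, as for tuples in the library); it is the Borel sigma-algebra. *)
Definition measure_rV_display : measure_display -> measure_display.
Proof. exact. Qed.

Section measurable_rV.
Context {R : realType} (d : nat).

Let coors : 'I_d -> 'rV[R]_d -> measurableTypeR R := fun i v => v ord0 i.

Let rV_set0 : g_sigma_preimage coors set0.
Proof. exact: sigma_algebra0. Qed.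

Let rV_setC A : g_sigma_preimage coors A -> g_sigma_preimage coors (~` A).
Proof. exact: sigma_algebraC. Qed.

Let rV_bigcup (F : _^nat) : (forall i, g_sigma_preimage coors (F i)) ->
  g_sigma_preimage coors (\bigcup_i (F i)).
Proof. exact: sigma_algebra_bigcup. Qed.

HB.instance Definition _ := @isMeasurable.Build
  (measure_rV_display default_measure_display) 'rV[R]_d
  (g_sigma_preimage coors) rV_set0 rV_setC rV_bigcup.

Lemma measurable_coord (i : 'I_d) :
  measurable_fun [set: 'rV[R]_d]
    ((fun v : 'rV[R]_d => v ord0 i) : 'rV[R]_d -> measurableTypeR R).
Proof.
move=> _ Y mY; rewrite setTI; apply: sub_sigma_algebra => /=.
rewrite -bigcup_seq/=; exists i => /=; first by rewrite mem_index_enum.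
by exists Y => //; rewrite setTI.
Qed.

Lemma measurable_fun_coordP d1 (T1 : measurableType d1) (f : T1 -> 'rV[R]_d) :
  measurable_fun [set: T1] f <->
  forall i, measurable_fun [set: T1]
    ((fun x => f x ord0 i) : T1 -> measurableTypeR R).
Proof.
split=> [mf i|mf].
  exact: (measurableT_comp (@measurable_coord i) mf).
move=> _ Y mY; rewrite setTI.
have : g_sigma_preimage (fun i => coors i \o f) `<=` measurable.
  apply: smallest_sub; first exact: sigma_algebra_measurable.
  rewrite -bigcup_seq/=; apply: bigcup_sub => i _ A [B mB <-].
  exact: mf.
by apply; rewrite g_sigma_preimage_comp; exists Y => //; rewrite setTI.
Qed.

End measurable_rV.

Section lebesgue_measure_rV.
Context {R : realType}.

(* (x, (v_0, .., v_(d-1))) |-> (x, v_0, .., v_(d-1)) *)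
Definition cons_rV d (z : measurableTypeR R * 'rV[R]_d) : 'rV[R]_d.+1 :=
  \row_i (if unlift ord0 i is Some j then z.2 ord0 j else z.1).

Lemma cons_rV0 d z : @cons_rV d z ord0 ord0 = z.1.
Proof. by rewrite mxE unlift_none. Qed.

Lemma cons_rVS d z j : @cons_rV d z ord0 (lift ord0 j) = z.2 ord0 j.
Proof. by rewrite mxE liftK. Qed.

Lemma measurable_cons_rV d : measurable_fun [set: _] (@cons_rV d).
Proof.
apply/measurable_fun_coordP => i; case: (unliftP ord0 i) => [j|] ->.
- under eq_fun do rewrite cons_rVS.
  exact: (measurableT_comp (@measurable_coord _ _ j) measurable_snd).
- under eq_fun do rewrite cons_rV0.
  exact: measurable_fst.
Qed.

HB.instance Definition _ d :=
  isMeasurableFun.Build _ _ _ _ (@cons_rV d) (@measurable_cons_rV d).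

Section lebesgue_cons.
Context d (m : {sigma_finite_measure set 'rV[R]_d -> \bar R}).

Definition lebesgue_cons : set 'rV[R]_d.+1 -> \bar R :=
  pushforward (@lebesgue_measure R \x m)%E (@cons_rV d).

Let lebesgue_cons0 : lebesgue_cons set0 = 0%E.
Proof. exact: measure0. Qed.

Let lebesgue_cons_ge0 A : (0 <= lebesgue_cons A)%E.
Proof. exact: measure_ge0. Qed.

Let lebesgue_cons_sigma_additive : semi_sigma_additive lebesgue_cons.
Proof. exact: measure_semi_sigma_additive. Qed.

HB.instance Definition _ := isMeasure.Build _ _ _ lebesgue_cons
  lebesgue_cons0 lebesgue_cons_ge0 lebesgue_cons_sigma_additive.

Let lebesgue_cons_sigma_finite : sigma_finite setT lebesgue_cons.
Proof.
have /sigma_finiteP[F [FT Fnd Foo]] := sigma_finiteT (@lebesgue_measure R).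
have /sigma_finiteP[G [GT Gnd Goo]] := sigma_finiteT m.
pose hd (v : 'rV[R]_d.+1) : measurableTypeR R := v ord0 ord0.
pose tl (v : 'rV[R]_d.+1) : 'rV[R]_d := \row_j v ord0 (lift ord0 j).
have mhd : measurable_fun setT hd by exact: measurable_coord.
have mtl : measurable_fun setT tl.
  apply/measurable_fun_coordP => i.
  by under eq_fun do rewrite mxE; exact: measurable_coord.
have hdE z : hd (@cons_rV d z) = z.1 by exact: cons_rV0.
have tlE z : tl (@cons_rV d z) = z.2.
  by apply/rowP => j; rewrite mxE cons_rVS.
exists (fun n => hd @^-1` F n `&` tl @^-1` G n).
  apply/seteqP; split => // v _.
  have [n _ Fn] : (\bigcup_i F i) (hd v) by rewrite -FT.
  have [k _ Gk] : (\bigcup_i G i) (tl v) by rewrite -GT.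
  exists (maxn n k) => //; split.
    by have /subsetPset := Fnd _ _ (leq_maxl n k); apply.
  by have /subsetPset := Gnd _ _ (leq_maxr n k); apply.
move=> n; have [mF Foon] := Foo n; have [mG Goon] := Goo n; split.
  apply: measurableI; first by rewrite -[X in measurable X]setTI; exact: mhd.
  by rewrite -[X in measurable X]setTI; exact: mtl.
have CE : @cons_rV d @^-1` (hd @^-1` F n `&` tl @^-1` G n) = F n `*` G n.
  by apply/seteqP; split => z /=; rewrite hdE tlE.
rewrite /lebesgue_cons /pushforward [X in (_ X < _)%E]CE.
by rewrite product_measure1E// lte_mul_pinfty// ge0_fin_numE.
Qed.

HB.instance Definition _ := Measure_isSigmaFinite.Build _ _ _ lebesgue_cons
  lebesgue_cons_sigma_finite.

End lebesgue_cons.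

(* Lebesgue measure on R^d: the d-fold product of the one on R. *)
Fixpoint lebesgue_rV d : {sigma_finite_measure set 'rV[R]_d -> \bar R} :=
  if d is d'.+1 then lebesgue_cons (lebesgue_rV d') else \d_(0 : 'rV[R]_0).

End lebesgue_measure_rV.

Section euclidean.
Context {R : realType} {d : nat}.
Implicit Types (x y v : 'rV[R]_d) (A : set 'rV[R]_d).

(* The library norm and balls on row vectors are those of the sup norm. *)
Definition enorm v : R := Num.sqrt (\sum_i v ord0 i ^+ 2).

Definition eball x (r : R) : set 'rV[R]_d := [set y | enorm (y - x) < r].

Definition diam A : \bar R :=
  ereal_sup [set (enorm (x - y))%:E | x in A & y in A].

Definition grad (f : 'rV[R]_d -> R) x : 'rV[R]_d :=
  \row_i 'D_(delta_mx ord0 i) f x.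

End euclidean.

(* A function on Omega is represented by a function on R^d, whose values
   outside Omega are irrelevant: all notions below depend only on its
   restriction to Omega, except for C1_near and the gradient bound in
   MRA2_local, where phi j k is the C^1 function near Omega that restricts to
   the basis function (on a general compact set the restriction does not
   determine the gradient). *)
Section functions_on.
Context {R : realType} {d : nat} (Omega : set 'rV[R]_d).
Local Notation E := 'rV[R]_d.
Local Notation C := R[i].
Local Notation mu := (lebesgue_rV (R := R) d).
Local Notation normc := Normc.normc.

Definition cplx (f : E -> R) : E -> C := fun x => (f x)%:C%C.

Definition cmeasurable (f : E -> C) :=
  measurable_fun Omega (fun x => complex.Re (f x)) /\
  measurable_fun Omega (fun x => complex.Im (f x)).

Definition cintegral (f : E -> C) : C :=
  Complex (\int[mu]_(x in Omega) complex.Re (f x))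
          (\int[mu]_(x in Omega) complex.Im (f x)).

Definition inner (f g : E -> C) : C := cintegral (fun x => f x * conjc (g x)).

Definition Lq_norm (q : R) (f : E -> C) : \bar R :=
  'N[mu]_(q%:E)[EFin \o ((fun x => normc (f x)) \_ Omega)]%E.

Definition Lq (q : R) : set (E -> C) :=
  [set f | cmeasurable f /\ (Lq_norm q f < +oo)%E].

Definition sup_norm (f : E -> C) : \bar R :=
  ereal_sup [set (normc (f x))%:E | x in Omega].

Definition supp (f : E -> R) : set E := closure [set x | Omega x /\ f x != 0].

(* support of a class of functions modulo null sets *)
Definition ess_supp (f : E -> R) : set E :=
  [set x | forall U, nbhs x U ->
     ~ {ae mu, forall y, Omega y -> U y -> f y = 0}].

Definition C1_near (f : E -> R) :=
  exists U : set E, [/\ open U, Omega `<=` U &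
    forall x, U x -> differentiable f x /\ {for x, continuous (grad f)}].

Definition span_on n (b : 'I_n -> E -> C) : set (E -> C) :=
  [set f | exists c : 'I_n -> C, {in Omega, forall x, f x = \sum_k c k * b k x}].

Definition basis_on n (b : 'I_n -> E -> C) (W : set (E -> C)) :=
  W = span_on b /\
  forall c : 'I_n -> C,
    {in Omega, forall x, \sum_k c k * b k x = 0} -> forall k, c k = 0.

End functions_on.

Section multiresolution.
Context {R : realType} {d : nat} (Omega : set 'rV[R]_d).
Local Notation E := 'rV[R]_d.
Local Notation C := R[i].
Local Notation mu := (lebesgue_rV (R := R) d).
Variables (V : nat -> set (E -> C)) (N : nat -> nat).
Variable phi : forall j, 'I_(N j).+1 -> E -> R.

Definition MRA1 :=
  [/\ forall j, exists n (b : 'I_n -> E -> C), V j = span_on Omega b,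
      V 0%N (cst 1),
      forall j, V j `<=` V j.+1,
      forall q : R, 1 < q -> forall j, V j `<=` Lq Omega q &
      forall q : R, 1 < q -> forall f, Lq Omega q f -> forall e : R, 0 < e ->
        exists j g, V j g /\ (Lq_norm Omega q (f \- g)%R < e%:E)%E].

(* "Stochastic" up to normalization: applying 2 ^ (- d (j + 1) / 2) times the
   partition of unity at the levels j and j + 1 to Phi_j = A Phi_(j+1) forces
   the columns of A to sum to 2 ^ (- d / 2), and not to 1. *)
Definition scaling_stochastic m n (A : 'M[R]_(m, n)) :=
  (forall k l, 0 <= A k l) /\
  forall l, \sum_k A k l = 2 `^ (- (d%:R / 2)).

Definition MRA2_local :=
  exists (c : R) (m : nat), 0 < c /\ forall j,
    [/\ forall k, (diam (supp Omega (@phi j k)) <= (c * 2 ^- j)%:E)%E,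
        forall k', (#|[pred k | `[< supp Omega (@phi j k) `&`
                       supp Omega (@phi j k') !=set0 >]]| <= m)%N &
        forall k, (ereal_sup [set (enorm (grad (@phi j k) x))%:E | x in Omega]
                     <= (c * 2 `^ (j%:R * (d%:R / 2 + 1)))%:E)%E].

Definition MRA2 :=
  [/\ forall j, basis_on Omega (fun k => cplx (@phi j k)) (V j),
      forall j k, C1_near Omega (@phi j k) /\
        {in Omega, forall x, 0 <= phi k x},
      forall j, exists2 A : 'M[R]_((N j).+1, (N j.+1).+1),
        scaling_stochastic A &
        forall k, {in Omega, forall x, phi k x = \sum_l A k l * phi l x},
      forall j, {in Omega, forall x,
        2 `^ (- ((d * j)%:R / 2)) * \sum_(k < (N j).+1) phi k x = 1} &
      MRA2_local].

(* P j is an operator on classes of functions modulo null sets *)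
Definition linear_projector (p : R) (W : set (E -> C))
    (Q : (E -> C) -> E -> C) :=
  [/\ forall f, Lq Omega p f -> W (Q f),
      forall f g, Lq Omega p f -> Lq Omega p g ->
        {ae mu, forall x, Omega x -> f x = g x} ->
        {in Omega, Q f =1 Q g},
      forall (a : C) f g, Lq Omega p f -> Lq Omega p g ->
        {in Omega, Q (fun x => a * f x + g x) =1 (fun x => a * Q f x + Q g x)} &
      forall f, W f -> {in Omega, Q f =1 f}].

Variables (p : R) (P : nat -> (E -> C) -> E -> C).

Definition MRA3 :=
  [/\ forall j, linear_projector p (V j) (P j),
      forall j, exists2 K : R, 0 <= K & forall f, cmeasurable Omega f ->
        (sup_norm Omega f < +oo)%E ->
        (sup_norm Omega (P j f) <= K%:E * sup_norm Omega f)%E &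
      forall f, Lq Omega p f ->
        (fun j => Lq_norm Omega p (f \- P j f)%R) @ \oo --> 0%E].

Definition biorthogonal_form (dphi : forall j, 'I_(N j).+1 -> E -> C) :=
  [/\ forall j k, Lq Omega 2 (@dphi j k),
      forall j h k,
        inner Omega (cplx (@phi j h)) (@dphi j k) = (h == k)%:R &
      forall j f, Lq Omega 2 f -> Lq Omega p f ->
        {in Omega, forall x,
          P j f x = \sum_k inner Omega f (@dphi j k) * cplx (@phi j k) x}].

End multiresolution.

Section sampling.
Context {R : realType} {d : nat} (Omega : set 'rV[R]_d).
Local Notation E := 'rV[R]_d.
Local Notation C := R[i].
Local Notation mu := (lebesgue_rV (R := R) d).
Variables (M : nat) (x : 'I_M.+1 -> E).

Definition dense_sampling (Delta : R) :=
  (forall l, Omega (x l)) /\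
  Omega = (\bigcup_(l in [set: 'I_M.+1]) eball (x l) Delta^-1) `&` Omega.

(* The psi l are elements of L^oo(Omega), so the conditions are modulo null
   sets; boundedness follows from the second one. *)
Definition partition_assoc (Delta : R) (psi : 'I_M.+1 -> E -> R) :=
  [/\ forall l, measurable_fun Omega (psi l),
      forall l, {ae mu, forall y, Omega y -> 0 <= psi l y <= 1},
      forall l, ess_supp Omega (psi l) `<=` eball (x l) Delta^-1 &
      {ae mu, forall y, Omega y -> \sum_l psi l y = 1}].

Variables (n : nat) (phi : 'I_n -> E -> R) (dphi : 'I_n -> E -> C).
Variable psi : 'I_M.+1 -> E -> R.

Definition M_mx : 'M[C]_(n, M.+1) :=
  \matrix_(k, l) inner Omega (cplx (psi l)) (dphi k).

Definition Phis_mx : 'M[C]_(M.+1, n) := \matrix_(l, k) cplx (phi k) (x l).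

Definition PQs_mx : 'M[C]_M.+1 := Phis_mx *m M_mx.

Definition omega : 'cV[C]_n := \col_k cintegral Omega (cplx (phi k)).

(* the pair (I^(i), u^(i)) *)
Fixpoint integrate_iter (v : 'cV[C]_M.+1) (i : nat) : C * 'cV[C]_M.+1 :=
  if i is i'.+1 then
    let I := (integrate_iter v i').1 in
    let u := (integrate_iter v i').2 in
    (I + (omega^T *m M_mx *m (v - u)) ord0 ord0, u + PQs_mx *m (v - u))
  else ((omega^T *m M_mx *m v) ord0 ord0, PQs_mx *m v).

Definition INTEGRATE (k : nat) (v : 'cV[C]_M.+1) : C :=
  (integrate_iter v k.+1).1.

End sampling.

(* Main.v *)
(** Write [A = 1 - M Phi^s] for the matrix, on the coefficients in the basis of
[V_j], of the error of the quasi-interpolant [f |-> P_j (sum_l f(x_l) psi_l)].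
On samples [Phi^s c] the procedure produces
[I^(i) = omega^T (c - A^(i+1) c)], a truncated Neumann series, so it converges
to [omega^T c], the integral, as soon as [A] is a contraction.  By
biorthogonality, the entries of [A] are the inner products of
[sum_l (phi_h - phi_h(x_l)) psi_l] with the dual functions, and the first factor
is uniformly small when [Delta] is large because [phi_h] is uniformly continuous
on the compact set [Omega]. *)
Require Import Defs.
From mathcomp Require Import all_boot all_order all_algebra.
From mathcomp Require Import finmap complex ring lra.
From mathcomp Require Import all_classical all_reals all_analysis.
From mathcomp Require Import measurable_realfun.

Set Implicit Arguments.
Unset Strict Implicit.
Unset Printing Implicit Defensive.

Import Order.TTheory GRing.Theory Num.Theory.
Import numFieldNormedType.Exports.

Local Open Scope classical_set_scope.
Local Open Scope ring_scope.

(** * Linear algebra of the correction iteration *)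

Section iteration.
Context {R : realType} {d : nat} (Omega : set 'rV[R]_d) {M n : nat}.
Variables (x : 'I_M.+1 -> 'rV[R]_d) (phi : 'I_n -> 'rV[R]_d -> R).
Variables (dphi : 'I_n -> 'rV[R]_d -> R[i]) (psi : 'I_M.+1 -> 'rV[R]_d -> R).

Local Notation iterate := (integrate_iter Omega x phi dphi psi).
Local Notation Mm := (M_mx Omega dphi psi).
Local Notation Phis := (Phis_mx x phi).
Local Notation w := (omega Omega phi).

(** The scalar component is updated from the vector one, so the induction has to carry both. *)
Lemma integrate_iter_linear (a b : R[i]) (f g : 'cV[R[i]]_M.+1) i :
  (iterate (a *: f + b *: g) i).1 =
    a * (iterate f i).1 + b * (iterate g i).1 /\
  (iterate (a *: f + b *: g) i).2 =
    a *: (iterate f i).2 + b *: (iterate g i).2.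
Proof.
have entry (u v : 'M[R[i]]_1) : (a *: u + b *: v) ord0 ord0 =
    a * u ord0 ord0 + b * v ord0 ord0 by rewrite !mxE.
elim: i => [|i [IH1 IH2]] /=; first by rewrite !mulmxDr -!scalemxAr entry.
rewrite IH1 IH2.
have -> : a *: f + b *: g - (a *: (iterate f i).2 + b *: (iterate g i).2) =
    a *: (f - (iterate f i).2) + b *: (g - (iterate g i).2).
  by rewrite !scalerBr opprD addrACA.
rewrite !(mulmxDr _ (a *: _)) -!scalemxAr; split.
  by rewrite entry !mulrDr addrACA.
by rewrite addrACA; congr (_ + _); exact/esym/scalerDr.
Qed.

Definition defect : 'M[R[i]]_n := 1%:M - Mm *m Phis.

(** The update telescopes: the new correction is [Mm *m Phis] applied to the current error
    [A^(i+1) c], that is [A^(i+1) c - A^(i+2) c]. The exponent is [i.+1] because the initial pair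
    already contains one application of [Mm *m Phis]. *)
Lemma integrate_iter_sample (c : 'cV[R[i]]_n) i :
  let r := c - iter i.+1 (mulmx defect) c in
  iterate (Phis *m c) i = ((w^T *m r) ord0 ord0, Phis *m r).
Proof.
have step (e : 'cV[R[i]]_n) : e - defect *m e = Mm *m Phis *m e.
  by rewrite /defect mulmxBl mul1mx opprB addrC subrK.
elim: i => [|i /= IH] /=.
  by rewrite step /PQs_mx !mulmxA.
rewrite IH /=; set e := defect *m iter i _ _.
have -> : Phis *m c - Phis *m (c - e) = Phis *m e.
  by rewrite -mulmxBr opprB addrC subrK.
have -> : c - defect *m e = (c - e) + Mm *m Phis *m e.
  by rewrite -step addrA subrK.
rewrite !mulmxDr /PQs_mx !mulmxA; congr pair.
by rewrite [RHS]mxE.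
Qed.

End iteration.

(** * Geometric decay of matrix powers and convergence in the complex numbers *)

(** A row has [n] entries of size at most [a], so each application of [A] multiplies a uniform bound
    on the entries by [n * a]; this is a contraction once [n * a < 1]. *)
Lemma iter_mulmx_le (K : numFieldType) n (A : 'M[K]_n) (c : 'cV[K]_n) (a S : K) :
  0 <= a -> (forall k h, `|A k h| <= a) -> (forall k, `|c k ord0| <= S) ->
  forall i k, `|(iter i (mulmx A) c) k ord0| <= (n%:R * a) ^+ i * S.
Proof.
move=> a0 Aa cS; elim=> [|i IH] k /=; first by rewrite expr0 mul1r.
rewrite mxE; apply: le_trans (ler_norm_sum _ _ _) _.
apply: (@le_trans _ _ (\sum_(h < n) a * ((n%:R * a) ^+ i * S))).
  apply: ler_sum => h _; rewrite normrM. apply: ler_pM => //; exact: IH.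
by rewrite sumr_const card_ord -[X in X <= _]mulr_natl exprS !mulrA.
Qed.

(* No archimedean structure is declared on R[i], hence the detour through the
   real part of epsilon. *)
Lemma geometric_cvg (R : realType) (S : R[i]) (s : nat -> R[i]^o) (l : R[i]^o) :
  (forall i, `|l - s i| <= 2^-1 ^+ i * S) -> s @ \oo --> l.
Proof.
move=> h; apply/cvgrPdist_lt => e; rewrite ltcE => /andP[/eqP/= Ime Ree].
(* The hypothesis at [i = 0] bounds a norm by [S], which forces [S] to be real. *)
have [T eT] : {T : R | S = T%:C%C}.
  exists (complex.Re S); have := le_trans (normr_ge0 _) (h 0%N).
  rewrite expr0 mul1r lecE /= => /andP[/eqP/= ImS _].
  by case: S h ImS => a b /= _ ->.
have eE : e = (complex.Re e)%:C%C by case: e Ime {Ree} => a b /= ->.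
have half_lt1 : `|2^-1 : R| < 1 by rewrite ger0_norm ?invf_lt1 ?ltr1n.
have /cvgrPdist_lt /(_ _ Ree) := @cvg_geometric R T _ half_lt1.
apply: filterS => i /=; rewrite sub0r normrN => small.
apply: le_lt_trans (h i) _; rewrite eT eE.
rewrite -(rmorph_nat (real_complex R) 2) -fmorphV -rmorphXn -rmorphM ltcR.
by rewrite mulrC; apply: le_lt_trans small; exact: ler_norm.
Qed.

(** * Euclidean balls, measurability of compact sets, uniform continuity *)

Section topology.
Context {R : realType} {d : nat}.
Implicit Types (Omega : set 'rV[R]_d).

Lemma enorm_continuous : continuous (@enorm R d).
Proof.
have sum_cont : continuous (fun v : 'rV[R]_d => \sum_i v ord0 i ^+ 2).
  apply: continuous_big => [|i _]; first exact: add_continuous.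
  move=> v; apply: (@continuous_comp _ _ _ (fun w : 'rV[R]_d => w ord0 i)
    (fun z : R => z ^+ 2)).
    exact: coord_continuous.
  exact: exprn_continuous.
by move=> v; apply: continuous_comp; [exact: sum_cont|exact: sqrt_continuous].
Qed.

Lemma open_eball (c : 'rV[R]_d) (r : R) : open (eball c r).
Proof.
have h : continuous (@enorm R d \o (fun y => y - c)).
  move=> y; apply: continuous_comp; last exact: enorm_continuous.
  by apply: continuousB; [exact: id|exact: cst_continuous].
have -> : eball c r = (@enorm R d \o (fun y => y - c)) @^-1` [set z | z < r] by [].
by apply: open_comp => //; exact: open_lt.
Qed.

Lemma normr_le_enorm (v : 'rV[R]_d) : `|v| <= enorm v.
Proof.
rewrite /Num.norm/= mx_normrE; apply/bigmax_leP; split; first exact: sqrtr_ge0.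
case=> i j _ /=; rewrite (ord1 i) -sqrtr_sqr ler_sqrt ?sumr_ge0//; last first.
  by move=> k _; exact: sqr_ge0.
by rewrite (bigD1 j)//= lerDl sumr_ge0// => k _; exact: sqr_ge0.
Qed.

Lemma measurable_mx_ball (c : 'rV[R]_d) (r : R) : 0 < r -> measurable (ball c r).
Proof.
move=> r0.
have -> : ball c r =
    \bigcap_(i in [set: 'I_d]) ((fun v : 'rV[R]_d => v ord0 i) @^-1`
      [set y | `|c ord0 i - y| < r]).
  apply/seteqP; split => v /=.
    by move=> [_ h] i _; exact: h.
  by move=> h; split => // i j; rewrite (ord1 i); exact: h.
apply: fin_bigcap_measurable => // i _.
rewrite -[X in measurable X]setTI; apply: measurable_coord => //.
by apply: open_measurable; exact: (@ball_open _ _ (c ord0 i : R^o) r).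
Qed.

(** The sigma-algebra is generated by the coordinates, so measurability is obtained from sup-norm
    balls: a compact set is the intersection over [n] of finite unions of balls of radius [1/(n+1)]
    centred in it. *)
Lemma compact_measurable Omega : compact Omega -> measurable Omega.
Proof.
move=> cO.
have fin n : exists2 D : {fset 'rV[R]_d}, {subset D <= Omega} &
    Omega `<=` \bigcup_(c in [set` D]) ball c n.+1%:R^-1.
  have := cO; rewrite compact_cover.
  move=> /(_ _ Omega (fun c => (ball c n.+1%:R^-1)°)) [c Oc|y Oy|D DO OD].
  - exact: open_interior.
  - by exists y => //; apply: nbhsx_ballx; rewrite invr_gt0.
  - exists D => //; apply: subset_trans OD _ => y [c Dc h]; exists c => //.
    exact: interior_subset h.
have {}fin n := cid2 (fin n).
have -> : Omega = \bigcap_n \bigcup_(c in [set` s2val (fin n)])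
    ball c n.+1%:R^-1.
  apply/seteqP; split => [y Oy n _|y hy]; first exact: (s2valP' (fin n)).
  (* A point of every such union is within [1/(n+1)] of [Omega] for all [n], hence lies in its
     closure. *)
  have : closed Omega by apply: compact_closed => //; exact: norm_hausdorff.
  apply => U /nbhs_ballP [e /= e0 eU].
  have [n ne] : exists n : nat, n.+1%:R^-1 < e.
    by have [n] := ltr_add_invr e0; rewrite add0r; exists n.
  have [c /= cD cy] := hy n I.
  exists c; split; first by apply/set_mem; exact: (s2valP (fin n)).
  by apply: eU; apply: ball_sym; apply: le_ball cy; exact: ltW.
apply: bigcapT_measurable => n; apply: fin_bigcup_measurable => // c _.
by apply: measurable_mx_ball; rewrite invr_gt0.
Qed.

(** The near-covering form of compactness turns the radius found around each [z] into one valid on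
    all of [Omega]. Stating the result for all small [r] lets finitely many functions share a
    radius. *)
Lemma compact_enorm_unif_continuous Omega (f : 'rV[R]_d -> R) (e : R) :
  compact Omega -> (forall y, Omega y -> {for y, continuous f}) -> 0 < e ->
  \forall r \near 0^'+, forall y z, Omega y -> Omega z -> enorm (y - z) < r ->
    `|f y - f z| <= e.
Proof.
move=> /compact_near_coveringP cO cf e0.
pose close (r : R) z := forall y, Omega y -> enorm (y - z) < r ->
  `|f y - f z| <= e.
suff : \forall r \near 0^'+, Omega `<=` close r.
  by apply: filterS => r h y z Oy Oz; exact: h.
apply: cO => z Oz.
have /cvgrPdist_lt /(_ (e / 2)) := cf _ Oz; rewrite divr_gt0// => /(_ isT).
move=> /nbhs_ballP [e1 /= e10 he1].
have e120 : 0 < e1 / 2 by rewrite divr_gt0.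
exists (ball z (e1 / 2), [set r | r < e1 / 2]); first split => /=.
- exact: nbhsx_ballx.
- exact: nbhs_right_lt.
(* Both [z'] and [y] lie in the ball of radius [e1] around [z], so both values are within [e / 2] of
   [f z]. *)
move=> [z' r] /= [zz' r12] y Oy yz'.
have fz' : `|f z - f z'| < e / 2.
  by apply: he1; apply: le_ball zz'; lra.
have fy : `|f z - f y| < e / 2.
  apply: he1; rewrite (splitr e1); apply: ball_triangle zz' _.
  rewrite mx_norm_ball /ball_ /= distrC.
  by apply: le_lt_trans (normr_le_enorm _) _; exact: lt_trans yz' _.
have -> : f y - f z' = (f z - f z') - (f z - f y) by ring.
apply: le_trans (ler_normB _ _) _; rewrite (splitr e) ltW//.
by rewrite ltrD.
Qed.
End topology.

(** * Real integrals against an integrable weight *)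

Section integration.
Context {dis : measure_display} {T : measurableType dis} {R : realType}.
Variables (mu : {measure set T -> \bar R}) (D : set T).
Hypothesis mD : measurable D.

(** Hölder's inequality for the exponents infinity and 1; the bound is only almost everywhere
    because the partition functions are classes modulo null sets. *)
Lemma integrable_ae_boundedM (u r : T -> R) (c : R) : 0 <= c ->
  measurable_fun D u -> {ae mu, forall x, D x -> `|u x| <= c} ->
  mu.-integrable D (EFin \o r) ->
  mu.-integrable D (EFin \o (u \* r)) /\
  `|\int[mu]_(x in D) (u x * r x)| <= c * \int[mu]_(x in D) `|r x|.
Proof.
move=> c0 mu_ uc ir; have mr : measurable_fun D r.
  by apply/measurable_EFinP; exact: (measurable_int mu).
have mur : measurable_fun D (u \* r) by exact: measurable_funM.
have inr : mu.-integrable D (EFin \o (fun x => `|r x|)) by exact: integrable_abse ir.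
have le : (\int[mu]_(x in D) `|(u x * r x)%:E| <=
    \int[mu]_(x in D) (c * `|r x|)%:E)%E.
  apply: ae_ge0_le_integral => //.
  - by apply: measurableT_comp => //; exact/measurable_EFinP.
  - by move=> x Dx; rewrite lee_fin mulr_ge0.
  - apply/measurable_EFinP; apply: measurable_funM => //.
    exact: measurableT_comp.
  - apply: filterS uc => x h Dx.
    by rewrite abse_EFin lee_fin normrM ler_wpM2r// h.
have icr : mu.-integrable D (EFin \o (fun x => c * `|r x|)).
  exact: (integrableZl mD c inr).
have iur : mu.-integrable D (EFin \o (u \* r)).
  apply/integrableP; split; first exact/measurable_EFinP.
  apply: le_lt_trans le _.
  rewrite -(@fineK _ (\int[mu]_(x in D) _)%E) ?ltry//.
  exact: integrable_fin_num.
split => //; apply: le_trans (le_normr_Rintegral mD iur) _.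
rewrite -RintegralZl// fine_le//; apply: integrable_fin_num => //.
exact: integrable_abse iur.
Qed.

Lemma integrable_sumr (I : Type) (s : seq I) (F : I -> T -> R) :
  (forall i, mu.-integrable D (EFin \o F i)) ->
  mu.-integrable D (EFin \o (fun x => \sum_(i <- s) F i x)).
Proof.
move=> iF; have := integrable_sum mD (P := xpredT) s (fun i _ => iF i).
by apply: eq_integrable => // x _; rewrite /= sumEFin.
Qed.

Lemma Rintegral_sum (I : Type) (s : seq I) (F : I -> T -> R) :
  (forall i, mu.-integrable D (EFin \o F i)) ->
  \int[mu]_(x in D) (\sum_(i <- s) F i x) = \sum_(i <- s) \int[mu]_(x in D) F i x.
Proof.
move=> iF; elim: s => [|i s IH].
  under eq_Rintegral do rewrite big_nil.
  by rewrite Rintegral_cst// mul0r big_nil.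
under eq_Rintegral do rewrite big_cons.
by rewrite big_cons RintegralD ?IH//; exact: integrable_sumr.
Qed.

(** On a set of finite measure, [|r| <= 1 + r^2] gives a dominating integrable function; the
    inequality follows from [(|r| - 1)^2 >= 0]. *)
Lemma integrable_sqr (r : T -> R) :
  (mu D < +oo)%E -> measurable_fun D r ->
  (\int[mu]_(x in D) (r x ^+ 2)%:E < +oo)%E -> mu.-integrable D (EFin \o r).
Proof.
move=> muD mr r2; have mr2 : measurable_fun D (fun x => r x ^+ 2).
  exact: measurable_funX.
have i1 : mu.-integrable D (EFin \o cst (1 : R)).
  apply/integrableP; split; first by apply/measurable_EFinP.
  under eq_integral do rewrite /= normr1.
  by rewrite integral_cst// mul1e.
have ir2 : mu.-integrable D (EFin \o (fun x => r x ^+ 2)).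
  apply/integrableP; split; first exact/measurable_EFinP.
  by under eq_integral do rewrite /= ger0_norm ?sqr_ge0//.
have := integrableD mD i1 ir2.
apply: le_integrable => //; first exact/measurable_EFinP.
move=> x _; rewrite !abse_EFin lee_fin [X in _ <= X]ger0_norm; last first.
  by rewrite addr_ge0// sqr_ge0.
rewrite /= -(real_normK (num_real (r x))).
have := sqr_ge0 (`|r x| - 1); have := normr_ge0 (r x); nra.
Qed.

(* As the [psi_l] sum to 1, [u - \sum_l v_l psi_l = \sum_l (u - v_l) psi_l],
   which is at most [e] almost everywhere. *)
Lemma sampling_error (M : nat) (u r : T -> R) (v : 'I_M -> R)
    (psi : 'I_M -> T -> R) (e : R) : 0 <= e ->
  measurable_fun D u -> (forall l, measurable_fun D (psi l)) ->
  (forall l, {ae mu, forall y, D y -> 0 <= psi l y <= 1}) ->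
  (forall l, {ae mu, forall y, D y -> psi l y != 0 -> `|u y - v l| <= e}) ->
  {ae mu, forall y, D y -> \sum_l psi l y = 1} ->
  mu.-integrable D (EFin \o r) ->
  `|\int[mu]_(y in D) (u y * r y) -
    \sum_l v l * \int[mu]_(y in D) (psi l y * r y)| <=
  e * \int[mu]_(y in D) `|r y|.
Proof.
move=> e0 mu_ mpsi psi01 psie psi1 ir.
have ipr l : mu.-integrable D (EFin \o (psi l \* r)).
  apply: (proj1 (integrable_ae_boundedM (c := 1) _ _ _ ir)) => //.
  by apply: filterS (psi01 l) => y h /h /andP[? ?]; rewrite ger0_norm.
have ivpr l : mu.-integrable D (EFin \o (fun y => v l * (psi l y * r y))).
  by have := integrableZl mD (v l) (ipr l).
pose w y := u y - \sum_l v l * psi l y.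
have mw : measurable_fun D w.
  apply: measurable_funB => //; apply: measurable_sum => l.
  by apply: measurable_funM.
have we : {ae mu, forall y, D y -> `|w y| <= e}.
  have /(filter_forall _) psi01' := psi01; have /(filter_forall _) psie' := psie.
  apply: filterS3 psi01' psie' psi1 => y h01 he h1 Dy.
  have -> : w y = \sum_l (u y - v l) * psi l y.
    rewrite /w -[in LHS](mulr1 (u y)) -(h1 Dy) mulr_sumr -sumrB.
    by apply: eq_bigr => l _; rewrite mulrBl.
  apply: le_trans (ler_norm_sum _ _ _) _.
  rewrite -[leRHS]mulr1 -(h1 Dy) mulr_sumr; apply: ler_sum => l _.
  have /andP[p0 _] := h01 l Dy.
  (* Nothing is known of [u y - v l] where [psi l] vanishes, but there the term is zero. *)
  rewrite normrM (ger0_norm p0); have [->|pn0] := eqVneq (psi l y) 0.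
    by rewrite !mulr0.
  by rewrite ler_wpM2r// he.
have [iwr wr] := integrable_ae_boundedM e0 mw we ir.
suff -> : \int[mu]_(y in D) (u y * r y) -
    \sum_l v l * \int[mu]_(y in D) (psi l y * r y) =
    \int[mu]_(y in D) (w y * r y) by [].
have -> : \int[mu]_(y in D) (u y * r y) =
    \int[mu]_(y in D) (w y * r y + \sum_l v l * (psi l y * r y)).
  apply: eq_Rintegral => y _; rewrite /w mulrBl mulr_suml.
  by under [X in _ = _ - X + _]eq_bigr do rewrite -mulrA; rewrite subrK.
rewrite RintegralD//; last exact: integrable_sumr.
rewrite Rintegral_sum//.
by rewrite (eq_bigr _ (fun l _ => RintegralZl (v l) mD (ipr l))) addrK.
Qed.

End integration.

(** * Essential supports and square-integrable functions on [Omega] *)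

Section omega.
Context {R : realType} {d : nat} (Omega : set 'rV[R]_d).
Local Notation mu := (lebesgue_rV (R := R) d).

(* Compactness turns the local vanishing in the definition of [ess_supp] into
   vanishing almost everywhere outside [U]. *)
Lemma ae_ess_supp (f : 'rV[R]_d -> R) (U : set 'rV[R]_d) :
  compact Omega -> open U -> ess_supp Omega f `<=` U ->
  {ae mu, forall y, Omega y -> f y != 0 -> U y}.
Proof.
move=> /compact_near_coveringP cO oU fU.
(* Near-covering, applied along the almost-everywhere filter in [y], yields a statement for all [z]
   in [Omega] at once; the guard [y = z] keeps only the diagonal, which is the claim. *)
pose good (y z : 'rV[R]_d) := y = z -> Omega y -> f y != 0 -> U y.
suff : \forall y \near almost_everywhere mu, Omega `<=` good y.
  by apply: filterS => y h Oy; exact: (h y Oy erefl Oy).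
apply: cO => z Oz; have [Uz|nUz] := pselect (U z).
  exists (U, setT) => /=; first by split; [exact: open_nbhs_nbhs|exact: filterT].
  by move=> [z' y] /= [Uz' _] -> _ _.
have [W Wz W0] : exists2 W, nbhs z W &
    {ae mu, forall y, Omega y -> W y -> f y = 0}.
  apply: contrapT => h; apply: nUz; apply: fU => W Wz W0.
  by apply: h; exists W.
exists (W, [set y | Omega y -> W y -> f y = 0]) => //= -[z' y] /= [Wz' h] yz' Oy.
by rewrite h ?eqxx// yz'.
Qed.

(** Splits the inner product with a real function into two real integrals; the sign on the imaginary
    part comes from the conjugation. *)
Lemma inner_cplx (u : 'rV[R]_d -> R) (g : 'rV[R]_d -> R[i]) :
  inner Omega (cplx u) g =
  Complex (\int[mu]_(y in Omega) (u y * complex.Re (g y)))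
          (\int[mu]_(y in Omega) (u y * - complex.Im (g y))).
Proof.
rewrite /inner /cintegral; congr Complex; apply: eq_Rintegral => y _.
  by case: (g y) => a b /=; ring.
by case: (g y) => a b /=; ring.
Qed.

Lemma ler_normc_add (z : R[i]) :
  `|z| <= (`|complex.Re z| + `|complex.Im z|)%:C%C.
Proof.
rewrite normc_def lecR -[leRHS]ger0_norm ?addr_ge0// -sqrtr_sqr.
rewrite ler_wsqrtr// sqrrD !real_normK ?num_real//.
by rewrite lerD2r lerDl mulrn_wge0// mulr_ge0.
Qed.

Lemma Lq2_sqr_lty (g : 'rV[R]_d -> R[i]) : Lq Omega 2 g ->
  (\int[mu]_(y in Omega) (complex.Re (g y) ^+ 2 + complex.Im (g y) ^+ 2)%:E
    < +oo)%E.
Proof.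
move=> [_]; rewrite /Lq_norm => /(@poweR_lty _ _ 2).
rewrite poweR_Lnorm//; congr (_ < _)%E.
rewrite [RHS]integral_mkcond; apply: eq_integral => y _.
rewrite /= !patchE; case: ifPn => _.
  congr EFin; case: (g y) => a b /=.
  rewrite (powR_mulrn 2) ?normr_ge0// real_normK ?num_real//.
  by rewrite sqr_sqrtr// addr_ge0 ?sqr_ge0.
(* Outside [Omega] the restricted function takes the default value [point], which is 0 in [R]. *)
by rewrite -[point]/(0 : R) normr0 powR0.
Qed.

Hypothesis mO : measurable Omega.

Lemma Lq2_cst1_lty : Lq Omega 2 (cst 1) -> (mu Omega < +oo)%E.
Proof.
move=> /Lq2_sqr_lty; under eq_integral do rewrite /= expr1n expr0n addr0.
by rewrite integral_cst// mul1e.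
Qed.

Lemma Lq2_integrable (g : 'rV[R]_d -> R[i]) : (mu Omega < +oo)%E ->
  Lq Omega 2 g ->
  mu.-integrable Omega (EFin \o (fun y => complex.Re (g y))) /\
  mu.-integrable Omega (EFin \o (fun y => complex.Im (g y))).
Proof.
move=> Ooo gL; have [[mRe mIm] _] := gL; have goo := Lq2_sqr_lty gL.
have mRe2 : measurable_fun Omega (fun y => complex.Re (g y) ^+ 2).
  exact: measurable_funX.
have mIm2 : measurable_fun Omega (fun y => complex.Im (g y) ^+ 2).
  exact: measurable_funX.
split; apply: integrable_sqr => //; apply: le_lt_trans goo;
  apply: ge0_le_integral => //;
  try by move=> y _; rewrite lee_fin ?addr_ge0 ?sqr_ge0.
- exact/measurable_EFinP.
- by apply/measurable_EFinP; exact: measurable_funD.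
- by move=> y _; rewrite lee_fin lerDl sqr_ge0.
- exact/measurable_EFinP.
- by apply/measurable_EFinP; exact: measurable_funD.
- by move=> y _; rewrite lee_fin lerDr sqr_ge0.
Qed.

End omega.

(** * Integrals over [V_j] and entries of the error matrix *)

Section defect_bound.
Context {R : realType} {d : nat} (Omega : set 'rV[R]_d).
Local Notation mu := (lebesgue_rV (R := R) d).

Lemma cintegral_lincomb n (c : 'I_n -> R[i]) (phi : 'I_n -> 'rV[R]_d -> R)
    (f : 'rV[R]_d -> R[i]) : measurable Omega ->
  (forall k, mu.-integrable Omega (EFin \o phi k)) ->
  {in Omega, forall y, f y = \sum_k c k * cplx (phi k) y} ->
  cintegral Omega f = \sum_k c k * cintegral Omega (cplx (phi k)).
Proof.
move=> mO iphi fE.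
have ReE y : y \in Omega -> complex.Re (f y) = \sum_k complex.Re (c k) * phi k y.
  move=> /fE ->; rewrite raddf_sum; apply: eq_bigr => k _.
  by case: (c k) => a b /=; ring.
have ImE y : y \in Omega -> complex.Im (f y) = \sum_k complex.Im (c k) * phi k y.
  move=> /fE ->; rewrite raddf_sum; apply: eq_bigr => k _.
  by case: (c k) => a b /=; ring.
have iphiZ (a : 'I_n -> R) k :
    mu.-integrable Omega (EFin \o (fun y => a k * phi k y)).
  exact: (integrableZl mO (a k) (iphi k)).
rewrite /cintegral (eq_Rintegral mu ReE) (eq_Rintegral mu ImE).
rewrite (Rintegral_sum mO _ (iphiZ _)) (Rintegral_sum mO _ (iphiZ _)).
have int0 : \int[mu]_(y in Omega) (0 : R) = 0 by rewrite Rintegral_cst// mul0r.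
apply/eqP; rewrite eq_complex !raddf_sum /=; apply/andP; split; apply/eqP;
  apply: eq_bigr => k _; rewrite int0 RintegralZl//; case: (c k) => a b /=; ring.
Qed.

Lemma defect_entry_le (M n : nat) (x : 'I_M.+1 -> 'rV[R]_d)
    (phi : 'I_n -> 'rV[R]_d -> R) (dphi : 'I_n -> 'rV[R]_d -> R[i])
    (psi : 'I_M.+1 -> 'rV[R]_d -> R) (Delta e : R) (k h : 'I_n) :
  compact Omega -> 0 <= e ->
  measurable_fun Omega (phi h) ->
  (forall y z, Omega y -> Omega z -> enorm (y - z) < Delta^-1 ->
    `|phi h y - phi h z| <= e) ->
  mu.-integrable Omega (EFin \o (fun y => complex.Re (dphi k y))) ->
  mu.-integrable Omega (EFin \o (fun y => complex.Im (dphi k y))) ->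
  inner Omega (cplx (phi h)) (dphi k) = (h == k)%:R ->
  dense_sampling Omega x Delta -> partition_assoc Omega x Delta psi ->
  `|defect Omega x phi dphi psi k h| <=
  (e * (\int[mu]_(y in Omega) `|complex.Re (dphi k y)| +
        \int[mu]_(y in Omega) `|complex.Im (dphi k y)|))%:C%C.
Proof.
move=> cO e0 mphi phie iRe iIm bio [Ox _] [mpsi psi01 psisupp psi1].
have mO : measurable Omega by exact: compact_measurable.
(* Almost everywhere that [psi l] is nonzero, [y] lies in the ball of radius [Delta^-1] around
   [x l]. *)
have psie l : {ae mu, forall y, Omega y -> psi l y != 0 ->
    `|phi h y - phi h (x l)| <= e}.
  have := ae_ess_supp cO (@open_eball _ _ _ _) (psisupp l).
  apply: filterS => y hy Oy py.
  by apply: phie => //; exact: hy.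
have iNIm : mu.-integrable Omega (EFin \o (fun y => - complex.Im (dphi k y))).
  exact: (integrableN iIm).
have err := sampling_error mO e0 mphi mpsi psi01 psie psi1.
have eRe := err _ iRe; have eIm := err _ iNIm.
have -> : defect Omega x phi dphi psi k h = Complex
    (\int[mu]_(y in Omega) (phi h y * complex.Re (dphi k y)) -
      \sum_l phi h (x l) * \int[mu]_(y in Omega) (psi l y * complex.Re (dphi k y)))
    (\int[mu]_(y in Omega) (phi h y * - complex.Im (dphi k y)) -
      \sum_l phi h (x l) * \int[mu]_(y in Omega) (psi l y * - complex.Im (dphi k y))).
  (* Biorthogonality rewrites the identity matrix entry as an inner product, so that both terms of
     the defect are integrals against [dphi k]. *)
  rewrite /defect !mxE eq_sym -bio inner_cplx.
  apply/eqP; rewrite eq_complex !raddfB !raddf_sum /=; apply/andP.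
  by split; apply/eqP; congr (_ + _); apply: eq_bigr => l _;
    rewrite !mxE inner_cplx /cplx /=; ring.
apply: le_trans (ler_normc_add _) _; rewrite lecR /= mulrDr lerD//.
by under [X in _ * X]eq_Rintegral do rewrite -normrN.
Qed.

End defect_bound.

(** * Choice of the density and convergence of the procedure *)

Theorem proposition4p1 (R : realType) (d : nat) (Omega : set 'rV[R]_d) (p : R)
    (V : nat -> set ('rV[R]_d -> R[i])) (N : nat -> nat)
    (phi : forall j, 'I_(N j).+1 -> 'rV[R]_d -> R)
    (P : nat -> ('rV[R]_d -> R[i]) -> 'rV[R]_d -> R[i])
    (dphi : forall j, 'I_(N j).+1 -> 'rV[R]_d -> R[i]) :
  compact Omega -> 1 < p ->
  MRA1 Omega V -> MRA2 Omega V phi -> MRA3 Omega V p P ->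
  biorthogonal_form Omega phi p P dphi ->
  forall j : nat, exists2 Delta : R, 0 < Delta &
    forall (M : nat) (x : 'I_M.+1 -> 'rV[R]_d) (psi : 'I_M.+1 -> 'rV[R]_d -> R),
      dense_sampling Omega x Delta ->
      partition_assoc Omega x Delta psi ->
      (forall (n : nat) (lambda mu : R[i]) (f g : 'cV[R[i]]_M.+1),
         INTEGRATE Omega x (phi j) (dphi j) psi n (lambda *: f + mu *: g) =
         lambda * INTEGRATE Omega x (phi j) (dphi j) psi n f +
         mu * INTEGRATE Omega x (phi j) (dphi j) psi n g) /\
      (forall f : 'rV[R]_d -> R[i], V j f ->
         (fun n => INTEGRATE Omega x (phi j) (dphi j) psi n (\col_l f (x l))
                     : R[i]^o) @ \oo --> (cintegral Omega f : R[i]^o)).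
Proof.
move=> cO _ [_ V01 _ VL _] [Vbasis phiC1 _ _ _] _ [dphiL bio _] j.
have mO : measurable Omega by exact: compact_measurable.
(* Finiteness of the measure is read off from the constant 1, which lies in [V_0] and hence in
   [L^2]. *)
have Ooo : (lebesgue_rV d Omega < +oo)%E.
  by apply: Lq2_cst1_lty => //; apply: (VL 2 _ 0%N) => //; rewrite ltr1n.
have [VE _] := Vbasis j.
have phiL k : Lq Omega 2 (cplx (phi j k)).
  apply: (VL 2 _ j); first by rewrite ltr1n.
  rewrite VE; exists (fun h => (h == k)%:R) => y _.
  rewrite (bigD1 k)//= eqxx mul1r big1 ?addr0// => h /negPf ->.
  by rewrite mul0r.
have mphi k : measurable_fun Omega (phi j k) by have [[]] := phiL k.
have iphi k : (lebesgue_rV d).-integrable Omega (EFin \o phi j k).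
  by have [] := Lq2_integrable mO Ooo (phiL k).
have phi_cont k y : Omega y -> {for y, continuous (phi j k)}.
  move=> Oy; have [[U [_ OU /(_ y (OU y Oy)) [dphi_y _]]] _] := phiC1 j k.
  exact: differentiable_continuous.
have idphi k := Lq2_integrable mO Ooo (dphiL j k).
pose G k := \int[lebesgue_rV d]_(y in Omega) `|complex.Re (dphi j k y)| +
  \int[lebesgue_rV d]_(y in Omega) `|complex.Im (dphi j k y)|.
have G0 k : 0 <= G k by rewrite addr_ge0// Rintegral_ge0.
(* Chosen so that [e * G k <= 1 / (2 (N_j + 1))], which makes the contraction factor of the
   [N_j + 1] square matrix equal to 1/2. The summand 1 keeps the denominator positive if all [G k]
   vanish. *)
pose e : R := (2 * (N j).+1%:R * (1 + \sum_k G k))^-1.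
have e0 : 0 < e by rewrite invr_gt0 !mulr_gt0// ltr_pwDl// sumr_ge0.
have eG k : e * G k <= (2 * (N j).+1%:R)^-1.
  rewrite /e invfM -mulrA ler_piMr ?invr_ge0// mulrC ler_pdivrMr ?mul1r.
    by rewrite (bigD1 k)//= addrCA lerDl addr_ge0// sumr_ge0.
  by rewrite ltr_pwDl// sumr_ge0.
have : \forall r \near 0^'+, forall k, forall y z, Omega y -> Omega z ->
    enorm (y - z) < r -> `|phi j k y - phi j k z| <= e.
  apply: filter_forall => k.
  by apply: compact_enorm_unif_continuous => //; exact: phi_cont.
(* The radius [r] depends only on [j], and is fixed before the sampling set and the partition; the
   density is its inverse. *)
move=> /(filterI (nbhs_right_gt 0)) /filter_ex [r [/= r0 phie]].
exists r^-1; first by rewrite invr_gt0.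
move=> M x psi dense part; split => [n a b f g|f].
  by have [] := integrate_iter_linear Omega x (phi j) (dphi j) psi a b f g n.+1.
rewrite VE => -[c fE].
pose cv : 'cV[R[i]]_(N j).+1 := \col_k c k.
have sampleE : \col_l f (x l) = Phis_mx x (phi j) *m cv.
  apply/colP => l; rewrite !mxE fE ?inE; last by have [] := dense.
  by apply: eq_bigr => k _; rewrite !mxE mulrC.
have intE : cintegral Omega f = ((omega Omega (phi j))^T *m cv) ord0 ord0.
  rewrite (cintegral_lincomb mO iphi fE) mxE.
  by apply: eq_bigr => k _; rewrite !mxE mulrC.
set A := defect Omega x (phi j) (dphi j) psi.
have Ale k h : `|A k h| <= ((2 * (N j).+1%:R)^-1)%:C%C.
  apply: le_trans (_ : (e * G k)%:C%C <= _); last by rewrite lecR.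
  have [iRe iIm] := idphi k.
  apply: (defect_entry_le cO (ltW e0) _ _ iRe iIm (bio j h k) dense part) => //.
  by rewrite invrK; exact: phie.
have cle k : `|cv k ord0| <= \sum_h `|cv h ord0|.
  by rewrite (bigD1 k)//= lerDl sumr_ge0.
set S := \sum_h `|cv h ord0|.
have a0 : 0 <= ((2 * (N j).+1%:R)^-1)%:C%C :> R[i] by rewrite ler0c invr_ge0.
have half : (N j).+1%:R * ((2 * (N j).+1%:R)^-1)%:C%C = 2^-1 :> R[i].
  by rewrite fmorphV rmorphM !rmorph_nat invfM mulrC -mulrA mulVf ?mulr1.
have powle := iter_mulmx_le a0 Ale cle.
pose W := \sum_k `|omega Omega (phi j) k ord0|.
apply: (@geometric_cvg _ (W * S)) => n.
rewrite /INTEGRATE sampleE (integrate_iter_sample Omega x (phi j) (dphi j) psi).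
rewrite intE -/A; set q := iter _ _ _.
have -> : ((omega Omega (phi j))^T *m cv) ord0 ord0 -
    ((omega Omega (phi j))^T *m (cv - q)) ord0 ord0 =
    ((omega Omega (phi j))^T *m q) ord0 ord0.
  have entryB (a b : 'M[R[i]]_1) : (a - b) ord0 ord0 = a ord0 ord0 - b ord0 ord0.
    by rewrite !mxE.
  by rewrite mulmxBr entryB opprB addrC subrK.
rewrite mxE; apply: le_trans (ler_norm_sum _ _ _) _.
rewrite mulrCA /W mulr_suml; apply: ler_sum => k _.
rewrite normrM mxE ler_wpM2l//; apply: le_trans (powle n.+2 k) _.
have S0 : 0 <= S by exact: sumr_ge0.
(* [INTEGRATE] at [n] is iterate [n.+1], whose error carries the power [n.+2]; the two extra factors
   1/2 are bounded by 1. *)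
rewrite half ler_wpM2r// exprSr exprSr -mulrA ler_piMr ?exprn_ge0 ?invr_ge0//.
by rewrite mulr_ile1 ?invr_ge0 ?invf_le1 ?ler1n ?ltr0n.
Qed.
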